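(* Let $n\ge 1$. There are $n$ coins, each of which has one of three possible weights $w_1<w_2<w_3$. The balance scale allows any number of coins on each pan. Then there is a strategy that sorts the coins and requires no more than $n+1$ weighings.
   Context: The coins are labelled and look identical; the assignment of the weights $w_1<w_2<w_3$ to the coins is unknown and arbitrary (in particular, not all three weights need occur), and the numerical values of the weights are unknown. A weighing on a balance scale with huge pans (pans of unlimited capacity) compares two disjoint sets of coins, one on each pan, and reports whether the total weights are equal, the left pan is lighter, or the left pan is heavier. A strategy is adaptive: each weighing may depend on the outcomes of the previous ones. To sort the coins means to determine the partition of the coins into groups such that coins in the same group weigh the same, coins in different groups have different weights, and for every two groups it is known which one contains the lighter coins. A strategy sorts the coins in at most $m$ weighings if, for all weights $w_1<w_2<w_3$ and every assignment of them to the coins, it uses at most $m$ weighings and its outcomes determine the sorting. *)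

(* Defs.v *)
From mathcomp Require Import all_boot all_order all_algebra.

Set Implicit Arguments.
Unset Strict Implicit.
Unset Printing Implicit Defensive.

Import Order.TTheory GRing.Theory Num.Theory.

Local Open Scope ring_scope.

Inductive outcome := Balanced | LeftLighter | LeftHeavier.

(* An adaptive strategy is a decision tree. A leaf announces the groups of
   equally heavy coins, listed from the lightest group to the heaviest one.
   The tree never mentions the weights: what it does and what it announces
   depend only on the outcomes seen so far. *)
Inductive strategy (n : nat) : Type :=
| Announce (groups : seq {set 'I_n})
| Weigh (A B : {set 'I_n}) (disjAB : [disjoint A & B])
        (next : outcome -> strategy n).

Definition weigh (R : realFieldType) (n : nat) (wt : 'I_n -> R)
    (A B : {set 'I_n}) : outcome :=
  let a := \sum_(i in A) wt i in
  let b := \sum_(i in B) wt i in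
  if a == b then Balanced else if a < b then LeftLighter else LeftHeavier.

Fixpoint num_weighings (R : realFieldType) (n : nat) (wt : 'I_n -> R)
    (s : strategy n) : nat :=
  match s with
  | Announce _ => 0%N
  | Weigh A B _ next => (num_weighings wt (next (weigh wt A B))).+1
  end.

Fixpoint announced (R : realFieldType) (n : nat) (wt : 'I_n -> R)
    (s : strategy n) : seq {set 'I_n} :=
  match s with
  | Announce groups => groups
  | Weigh A B _ next => announced wt (next (weigh wt A B))
  end.

Definition is_sorting (R : realFieldType) (n : nat) (wt : 'I_n -> R)
    (groups : seq {set 'I_n}) : Prop :=
  [/\ partition [set G in groups] [set: 'I_n],
      forall G, G \in groups -> {in G &, forall i j, wt i = wt j}
    & pairwise (fun G H : {set 'I_n} =>
                  [forall i in G, forall j in H, wt i < wt j]) groups].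

(* The weights are arbitrary elements of an ordered field, not necessarily
   positive, and not all of w1, w2, w3 need occur among the coins. *)
Definition sorts_within (R : realFieldType) (n m : nat) (s : strategy n) :
    Prop :=
  forall (w1 w2 w3 : R) (wt : 'I_n -> R),
    w1 < w2 -> w2 < w3 -> (forall i, wt i \in [:: w1; w2; w3]) ->
    (num_weighings wt s <= m)%N /\ is_sorting wt (announced wt s).

Arguments sorts_within R {n} m s.

(* Main.v *)
(* Compare one coin with the others until some coin differs from it; this gives
   two weights a < b and leaves two weighings more than there are unsorted
   coins. From then on unsorted coins c, d are compared in pairs. If c > d, a
   balance of c + d against a + b means c = b, d = a. If c = d, the pair is kept
   until a second equal pair p = p' appears; then c + p is weighed against
   a + b. If it balances, one weighing of c against p decides; if it is lighter,
   2c = p + a holds only if both are a; if it is heavier, 2c = p + b holds only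
   if both are b. So two coins cost two weighings as long as no third weight
   shows up. When one does, the two spare weighings (both coins against a, or
   both against b, according to the sign of the last sum) place it, and each
   remaining coin costs one weighing against the middle weight. *)
Require Import Defs.
From mathcomp Require Import all_boot all_order all_algebra.
From mathcomp Require Import lra zify.

Set Implicit Arguments.
Unset Strict Implicit.
Unset Printing Implicit Defensive.

Import Order.TTheory GRing.Theory Num.Theory.

Local Open Scope ring_scope.

Section Sorting.

Variables (R : realFieldType) (n : nat).
Implicit Types (wt : 'I_n -> R) (P Q : ('I_n -> R) -> Prop).
Implicit Types (S : {set 'I_n}) (f : 'I_n -> nat).
Implicit Types (a b c d e i j p u v x y z : 'I_n).

(** * Sorting within a budget of weighings *)

(** [P] stands for what the outcomes so far have revealed. The strategy is chosen before [wt], so it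
    has to serve every weight function compatible with [P]. *)
Definition within m P : Prop :=
  exists s : strategy n, forall wt, P wt ->
    (num_weighings wt s <= m)%N /\ is_sorting wt (announced wt s).

Lemma within_weaken m m' P Q :
  (m <= m')%N -> (forall wt, Q wt -> P wt) -> within m P -> within m' Q.
Proof.
move=> le_mm' sQP [s sP]; exists s => wt /sQP /sP [le_m srt].
by split=> //; exact: leq_trans le_m le_mm'.
Qed.

Lemma within_absurd m P : (forall wt, ~ P wt) -> within m P.
Proof. by move=> noP; exists (Announce [::]) => wt /noP. Qed.

Lemma within_weigh m P (A B : {set 'I_n}) : [disjoint A & B] ->
    within m (fun wt => P wt /\ \sum_(i in A) wt i = \sum_(i in B) wt i) ->
    within m (fun wt => P wt /\ \sum_(i in A) wt i < \sum_(i in B) wt i) ->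
    within m (fun wt => P wt /\ \sum_(i in B) wt i < \sum_(i in A) wt i) ->
  within m.+1 P.
Proof.
move=> disjAB [s0 h0] [s1 h1] [s2 h2].
exists (Weigh disjAB (fun o => match o with
  Balanced => s0 | LeftLighter => s1 | LeftHeavier => s2 end)) => wt Pwt.
rewrite /= ltnS /weigh.
by case: ltgtP => cmp; [exact: h1 | exact: h2 | exact: h0].
Qed.

Lemma within_weigh1 m P i j : i != j ->
    within m (fun wt => P wt /\ wt i = wt j) ->
    within m (fun wt => P wt /\ wt i < wt j) ->
    within m (fun wt => P wt /\ wt j < wt i) ->
  within m.+1 P.
Proof.
move=> ij h0 h1 h2; apply: (@within_weigh _ _ [set i] [set j]).
- by rewrite disjoints1 inE.
- by apply: within_weaken h0 => // wt; rewrite !big_set1.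
- by apply: within_weaken h1 => // wt; rewrite !big_set1.
- by apply: within_weaken h2 => // wt; rewrite !big_set1.
Qed.

Lemma within_weigh2 m P i j k l : uniq [:: i; j; k; l] ->
    within m (fun wt => P wt /\ wt i + wt j = wt k + wt l) ->
    within m (fun wt => P wt /\ wt i + wt j < wt k + wt l) ->
    within m (fun wt => P wt /\ wt k + wt l < wt i + wt j) ->
  within m.+1 P.
Proof.
rewrite /= !inE !negb_or => /and4P[/and3P[ij ik il] /andP[jk jl] kl _].
have sum2 u v wt : u != v -> \sum_(t in [set u; v]) wt t = wt u + wt v.
  by move=> uv; rewrite big_setU1 ?inE // big_set1.
move=> h0 h1 h2; apply: (@within_weigh _ _ [set i; j] [set k; l]).
- rewrite disjoint_subset; apply/subsetP => t.
  by rewrite !inE => /orP[] /eqP->; apply/norP.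
- by apply: within_weaken h0 => // wt; rewrite !sum2.
- by apply: within_weaken h1 => // wt; rewrite !sum2.
- by apply: within_weaken h2 => // wt; rewrite !sum2.
Qed.

(** * Recording the known order of the coins by numbers *)

(* [f] numbers the weights seen so far; only the order of the numbers counts. *)
Definition agrees f S wt : Prop :=
  {in S &, forall i j, (wt i < wt j) = (f i < f j)%N}.

Lemma agrees_eq f S wt i j :
  agrees f S wt -> i \in S -> j \in S -> f i = f j -> wt i = wt j.
Proof.
move=> ag iS jS fij; apply/eqP.
by rewrite eq_le !leNgt !ag // fij ltnn.
Qed.

(** The groups are the fibres of [f], listed by increasing number. Numbers that no coin carries give
    empty fibres, which a partition must not contain. *)
Lemma agreesT_sorting f wt : agrees f [set: 'I_n] wt ->
  is_sorting wt [seq G <- [seq [set i | f i == r]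
                          | r <- iota 0 (\max_i f i).+1] | G != set0].
Proof.
move=> ag; set gs := filter _ _.
have memP G : reflect (exists i, G = [set j | f j == f i]) (G \in gs).
  apply: (iffP idP).
    rewrite mem_filter => /andP[/set0Pn[i iG] /mapP[r _ defG]].
    by exists i; move: iG; rewrite defG inE => /eqP->.
  case=> i ->; rewrite mem_filter; apply/andP; split.
    by apply/set0Pn; exists i; rewrite inE.
  by apply: map_f; rewrite mem_iota /= ltnS (leq_bigmax i).
split.
- suff -> : [set G in gs] = preim_partition f [set: 'I_n]
    by exact: preim_partitionP.
  apply/setP=> G; rewrite inE; apply/memP/imsetP => [[i ->]|[i _ ->]].
    by exists i => //; apply/setP=> j; rewrite !inE eq_sym.
  by exists i; apply/setP=> j; rewrite !inE eq_sym.
- move=> _ /memP[k ->] i j; rewrite !inE => /eqP fi /eqP fj.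
  by apply: (agrees_eq ag); rewrite ?inE // fi.
- apply: pairwise_filter; rewrite pairwise_map.
  apply: (@sub_pairwise _ ltn) => [r t rt|].
    apply/forall_inP=> i; rewrite inE => /eqP fi.
    apply/forall_inP=> j; rewrite inE => /eqP fj.
    by rewrite ag ?inE // fi fj.
  by rewrite -sorted_pairwise ?iota_ltn_sorted //; exact: ltn_trans.
Qed.

(** The hypothesis on the weights, freed of the values [w1], [w2], [w3]: among any four coins two
    weigh the same. *)
Definition three_valued wt : Prop :=
  forall i j k l, ~~ uniq [:: wt i; wt j; wt k; wt l].

Definition known f S wt : Prop := three_valued wt /\ agrees f S wt.

Lemma within_sorted m f P :
  (forall wt, P wt -> known f [set: 'I_n] wt) -> within m P.
Proof.
(* The groups are left to unification with [agreesT_sorting]; they depend on [f] only, so one leaf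
   serves all [wt]. *)
move=> knP; eexists (Announce _) => wt /knP[_ ag].
by split=> //; exact: agreesT_sorting ag.
Qed.

Lemma three_valuedP wt i j k l : three_valued wt ->
  [\/ wt i = wt j, wt i = wt k, wt i = wt l |
   [\/ wt j = wt k, wt j = wt l | wt k = wt l]].
Proof.
move=> /(_ i j k l); rewrite /= !inE !negb_and !negbK orbF.
case/or3P=> [/or3P[]|/orP[]|] /eqP e.
- exact: Or41.
- exact: Or42.
- exact: Or43.
- by apply/Or44/Or31.
- by apply/Or44/Or32.
- by apply/Or44/Or33.
Qed.

Definition put f i r : 'I_n -> nat := fun k => if k == i then r else f k.

Lemma put_same f i r : put f i r i = r.
Proof. by rewrite /put eqxx. Qed.

Lemma put_other f i r k : k != i -> put f i r k = f k.
Proof. by rewrite /put => /negbTE->. Qed.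

Lemma put_in f i r S k : i \notin S -> k \in S -> put f i r k = f k.
Proof. by move=> iS kS; rewrite put_other //; apply: contraNneq iS => <-. Qed.

Lemma known_put f S wt i r : known f S wt ->
    {in S, forall k, (wt i < wt k) = (r < f k)%N /\
                     (wt k < wt i) = (f k < r)%N} ->
  known (put f i r) (i |: S) wt.
Proof.
move=> [th ag] ir; split=> // j k.
rewrite !inE /put.
case: (eqVneq j i) => [->|_]; case: (eqVneq k i) => [->|_] //=.
- by rewrite ltxx ltnn.
- by move=> _ /ir[].
- by move=> /ir[].
- exact: ag.
Qed.

Lemma known_put_eq f S wt i e : known f S wt -> e \in S -> wt i = wt e ->
  known (put f i (f e)) (i |: S) wt.
Proof.
move=> kn eS ie; apply: known_put => // k kS.
by rewrite ie; split; apply: kn.2.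
Qed.

Lemma cardsCU1 S i : i \notin S -> #|~: S| = #|~: (i |: S)|.+1.
Proof.
move=> iS; rewrite setCU (cardsD1 i (~: S)) inE iS add1n.
by rewrite setIC setDE.
Qed.

(** * Three known weights: one weighing per coin *)

Definition rank3 f S x y z : Prop :=
  [/\ x \in S, y \in S, z \in S & (f x < f y < f z)%N].

Lemma rank3_put f S x y z i r : i \notin S ->
  rank3 f S x y z -> rank3 (put f i r) (i |: S) x y z.
Proof.
move=> iS [xS yS zS lt]; split; rewrite ?inE ?xS ?yS ?zS ?orbT //.
by rewrite !(put_in _ _ iS).
Qed.

(** The coin is weighed against the middle weight. If it is lighter, it weighs as much as [x], and
    if heavier, as much as [z], since a fourth weight is impossible. *)
Lemma within_classify m S f x y z i P : rank3 f S x y z -> i \notin S ->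
    (forall wt, P wt -> known f S wt) ->
    (forall e, e \in S -> within m (fun wt => P wt /\ wt i = wt e)) ->
  within m.+1 P.
Proof.
move=> [xS yS zS /andP[xy yz]] iS knP h.
have iy : i != y by apply: contraNneq iS => ->.
apply: (within_weigh1 iy) (h y yS) _ _.
- apply: within_weaken (h x xS) => // wt [Pwt lt]; split=> //.
  have [th ag] := knP _ Pwt; move: xy yz; rewrite -!ag // => xy yz.
  by case: (three_valuedP x y z i th) => [||| []]; lra.
- apply: within_weaken (h z zS) => // wt [Pwt lt]; split=> //.
  have [th ag] := knP _ Pwt; move: xy yz; rewrite -!ag // => xy yz.
  by case: (three_valuedP x y z i th) => [||| []]; lra.
Qed.

Lemma within_rank3 S f x y z P : rank3 f S x y z ->
  (forall wt, P wt -> known f S wt) -> within #|~: S| P.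
Proof.
have [k] := ubnP #|~: S|; elim: k S f P => // k IH S f P ltSk r3 knP.
case: (set_0Vmem (~: S)) => [ST | [i]].
  apply: (@within_sorted _ f) => wt /knP.
  by rewrite -[S]setCK ST setC0.
rewrite inE => iS; rewrite (cardsCU1 iS).
apply: (within_classify r3 iS knP) => e eS.
apply: (IH _ (put f i (f e))); last 2 first.
- exact: rank3_put.
- by move=> wt [/knP kn ie]; exact: known_put_eq.
- by rewrite -ltnS -(cardsCU1 iS).
Qed.

(** * Keeping a balanced pair of unsorted coins *)

(* A pair of unsorted coins known to balance, which has cost only one weighing:
   the budget below is one less while such a pair is kept. *)
Definition pending S (q : option ('I_n * 'I_n)) P : Prop :=
  if q is Some (p, p') then
    [/\ p \notin S, p' \notin S, p != p' & forall wt, P wt -> wt p = wt p']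
  else True.

Definition avoids (q : option ('I_n * 'I_n)) i : bool :=
  if q is Some (p, p') then (i != p) && (i != p') else true.

Lemma pending_sub S q P Q :
  (forall wt, Q wt -> P wt) -> pending S q P -> pending S q Q.
Proof. by case: q => [[p p']|] //= sQP [-> -> -> eqP]; split=> // wt /sQP /eqP. Qed.

Lemma pending_setU1 S q P i :
  avoids q i -> pending S q P -> pending (i |: S) q P.
Proof.
case: q => [[p p']|] //= /andP[ip ip'] [pS pS' pp' eqP].
by rewrite !inE !negb_or ![_ == i]eq_sym ip ip' pS pS'.
Qed.

Lemma cardsCU2 S i j : i \notin S -> j \notin S -> i != j ->
  #|~: S| = #|~: (j |: (i |: S))|.+2.
Proof.
move=> iS jS ij; rewrite (cardsCU1 iS) (@cardsCU1 (i |: S) j) //.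
by rewrite !inE negb_or eq_sym ij.
Qed.

(** Classifying [p] also sorts [p'], so the kept pair costs one weighing instead of two. *)
Lemma within_rank3_pending S f x y z q P : rank3 f S x y z ->
    pending S q P -> (forall wt, P wt -> known f S wt) ->
  within (#|~: S| - isSome q) P.
Proof.
case: q => [[p p'] r3 /= [pS p'S pp' eqP] knP|r3 _ knP]; last first.
  by rewrite subn0; exact: (within_rank3 r3).
rewrite (cardsCU2 pS p'S pp') subn1 /=.
have p'S1 : p' \notin p |: S by rewrite !inE negb_or eq_sym pp'.
apply: (within_classify r3 pS knP) => e eS.
pose f1 := put f p (f e).
apply: (@within_rank3 _ (put f1 p' (f1 p)) x y z).
  by do 2![apply: rank3_put => //].
move=> wt [Pwt pe]; apply: known_put_eq; rewrite ?setU11 ?(eqP _ Pwt) //.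
by apply: known_put_eq => //; exact: knP.
Qed.

(** * Two known weights *)

(* The numbers 0, 2 and 4 stay free for a third weight found later. *)
Definition rank2 f S a b : Prop :=
  [/\ a \in S, b \in S, f a = 1%N, f b = 3
    & {in S, forall k, f k = f a \/ f k = f b}].

Lemma rank2_put f S a b i e : rank2 f S a b -> i \notin S -> e \in S ->
  rank2 (put f i (f e)) (i |: S) a b.
Proof.
move=> [aS bS fa fb fS] iS eS; rewrite /rank2 !(put_in _ _ iS) // !inE aS bS.
rewrite !orbT; split=> // k; rewrite !inE.
case: (eqVneq k i) => [-> _|ki /= kS]; first by rewrite put_same; exact: fS.
by rewrite put_other //; exact: fS.
Qed.

(** The three gaps around the numbers 1 and 3 of [a] and [b]: below both, between them, above
    both. *)
Definition new_rank wt a b i (r : nat) : Prop :=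
  match r with
  | 0 => wt i < wt a
  | 2 => wt a < wt i /\ wt i < wt b
  | 4 => wt b < wt i
  | _ => False
  end.

Lemma rank2_lt f S a b wt : rank2 f S a b -> known f S wt -> wt a < wt b.
Proof. by move=> [aS bS fa fb _] [_ ag]; rewrite ag // fa fb. Qed.

Lemma rank2_put_new f S a b i r : rank2 f S a b -> i \notin S ->
  r \in [:: 0; 2; 4]%N -> exists x y z, rank3 (put f i r) (i |: S) x y z.
Proof.
move=> [aS bS fa fb _] iS.
have iU : i \in i |: S by rewrite setU11.
have aU : a \in i |: S by rewrite setU1r.
have bU : b \in i |: S by rewrite setU1r.
rewrite !inE => /or3P[] /eqP->; [exists i, a, b|exists a, i, b|exists a, b, i];
  by split=> //; rewrite put_same !(put_in _ _ iS) // fa fb.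
Qed.

(** Comparisons with [a] and [b] suffice, since every coin of [S] weighs as much as one of them. *)
Lemma known_put_new f S a b i r wt : rank2 f S a b -> known f S wt ->
  new_rank wt a b i r -> known (put f i r) (i |: S) wt.
Proof.
move=> r2 kn new; have ab := rank2_lt r2 kn.
have [aS bS fa fb fS] := r2.
have [ia ai ib bi] : [/\ (wt i < wt a) = (r < 1)%N, (wt a < wt i) = (1 < r)%N,
    (wt i < wt b) = (r < 3)%N & (wt b < wt i) = (3 < r)%N].
  case: r new => [|[|[|[|[|r]]]]] //= => [|[]|] *;
    by split; apply/idP/idP; rewrite -?leNgt; lra.
apply: known_put => // k kS; case: (fS k kS) => fk.
- by rewrite (agrees_eq kn.2 kS aS fk) fk fa.
- by rewrite (agrees_eq kn.2 kS bS fk) fk fb.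
Qed.

(** A coin lighter than [a] has the third weight at once; only a coin heavier than [a] must also be
    weighed against [b]. *)
Lemma within_locate m S f a b i P : rank2 f S a b -> i \notin S ->
    (forall wt, P wt -> known f S wt) ->
    (forall r, r \in [:: 0; 2; 4]%N ->
       within m (fun wt => P wt /\ new_rank wt a b i r)) ->
    (forall e, e \in S -> within m (fun wt => P wt /\ wt i = wt e)) ->
  within m.+2 P.
Proof.
move=> [aS bS _ _ _] iS knP hnew hold.
have ia : i != a by apply: contraNneq iS => ->.
have ib : i != b by apply: contraNneq iS => ->.
apply: (within_weigh1 ia).
- exact: within_weaken (hold a aS).
- exact: within_weaken (hnew 0%N isT).
apply: (within_weigh1 ib).
- by apply: within_weaken (hold b bS) => // wt [[]].
- by apply: within_weaken (hnew 2 isT) => // wt [[]].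
- by apply: within_weaken (hnew 4 isT) => // wt [[]].
Qed.

(** Locating [p] settles [p']. The case [p = p'] is allowed and handles a single last coin. *)
Lemma within_last S f a b p p' P : rank2 f S a b -> p \notin S ->
    (forall i, i \in p' |: (p |: S)) -> (forall wt, P wt -> wt p = wt p') ->
    (forall wt, P wt -> known f S wt) ->
  within 2 P.
Proof.
move=> r2 pS allS eqP knP.
have ST : p' |: (p |: S) = [set: 'I_n] by apply/setP=> i; rewrite allS inE.
apply: (within_locate r2 pS knP) => [r _|e eS].
- apply: (@within_sorted _ (put (put f p r) p' (put f p r p))).
  move=> wt [Pwt new]; rewrite -ST.
  apply: known_put_eq; rewrite ?setU11 ?(eqP _ Pwt) //.
  by apply: known_put_new new => //; exact: knP.
- apply: (@within_sorted _ (put (put f p (f e)) p' (put f p (f e) p))).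
  move=> wt [Pwt pe]; rewrite -ST.
  apply: known_put_eq; rewrite ?setU11 ?(eqP _ Pwt) //.
  by apply: known_put_eq => //; exact: knP.
Qed.

(** * Two coins of which at least one has the third weight *)

(* Leaves the numbering open, since it depends on where the third weight lies. *)
Definition within_any_rank3 m S P : Prop := forall f x y z,
  rank3 f S x y z -> within m (fun wt => P wt /\ known f S wt).

(** Here [c] shows the third weight, and [d] may share it: [e] ranges over [c |: S], so that [e = c]
    is possible. *)
Lemma within_new_old m S f a b c d e r P Q : rank2 f S a b ->
    c \notin S -> d \notin c |: S -> e \in c |: S -> r \in [:: 0; 2; 4]%N ->
    within_any_rank3 m (d |: (c |: S)) P ->
    (forall wt, Q wt ->
       [/\ P wt, known f S wt, new_rank wt a b c r & wt d = wt e]) ->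
  within m Q.
Proof.
move=> r2 cS dS eS rP h hQ; pose f1 := put f c r.
have [x [y [z r3]]] := rank2_put_new r2 cS rP.
apply: within_weaken (h (put f1 d (f1 e)) x y z (rank3_put _ dS r3)) => //.
move=> wt /hQ[Pwt kn new de]; split=> //.
by apply: known_put_eq => //; exact: known_put_new new.
Qed.

Lemma within_old_new m S f a b c d e r P Q : rank2 f S a b ->
    c \notin S -> d \notin c |: S -> e \in S -> r \in [:: 0; 2; 4]%N ->
    within_any_rank3 m (d |: (c |: S)) P ->
    (forall wt, Q wt ->
       [/\ P wt, known f S wt, wt c = wt e & new_rank wt a b d r]) ->
  within m Q.
Proof.
move=> r2 cS dS eS rP h hQ; pose f1 := put f c (f e).
have r2' : rank2 f1 (c |: S) a b by exact: rank2_put.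
have [x [y [z r3]]] := rank2_put_new r2' dS rP.
apply: within_weaken (h (put f1 d r) x y z r3) => //.
move=> wt /hQ[Pwt kn ce new]; split=> //.
by apply: known_put_new new => //; exact: known_put_eq.
Qed.

Ltac three_cases a b c d :=
  match goal with th : three_valued ?wt |- _ =>
    case: (three_valuedP a b c d th) => [||| []] ?
  end.

(** With only the weights of [a] and [b], a sum below theirs would force both coins to equal [a],
    which is excluded. So a third weight occurs, and weighing both coins against [a] places it:
    below [a] if some coin is lighter than [a], otherwise between [a] and [b]. *)
Lemma within_light m S f a b c d P : rank2 f S a b ->
    c \notin S -> d \notin c |: S ->
    (forall wt, P wt -> known f S wt) ->
    (forall wt, P wt -> wt c + wt d < wt a + wt b) ->
    (forall wt, P wt -> wt c = wt a -> wt d <> wt a) ->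
    within_any_rank3 m (d |: (c |: S)) P ->
  within m.+2 P.
Proof.
move=> r2 cS dS knP light notaa h.
have [aS bS _ _ _] := r2.
have [aS' bS'] : a \in c |: S /\ b \in c |: S by rewrite !setU1r.
have cS' : c \in c |: S by rewrite setU11.
have ca : c != a by apply: contraNneq cS => ->.
have da : d != a by apply: contraNneq dS => ->.
have facts wt : P wt -> [/\ known f S wt, three_valued wt, wt a < wt b,
    wt c + wt d < wt a + wt b & wt c = wt a -> wt d <> wt a].
  move=> Pwt; have kn := knP _ Pwt.
  by split; [|exact: kn.1|exact: rank2_lt kn|exact: light|exact: notaa].
apply: (within_weigh1 ca); apply: (within_weigh1 da).
- apply: within_absurd => wt [[/facts[_ _ _ _ aa] ?] ?]; exact: aa.
- apply: (within_old_new (r := 0%N) r2 cS dS aS _ h) => // wt.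
  by move=> [[Pwt ?] ?]; split=> //; exact: knP.
- apply: (within_old_new (r := 2) r2 cS dS aS _ h) => // wt.
  move=> [[Pwt ?] ?]; have [kn th ab sum _] := facts _ Pwt.
  by split=> //; split=> //; lra.
- apply: (within_new_old (r := 0%N) r2 cS dS aS' _ h) => // wt.
  by move=> [[Pwt ?] ?]; split=> //; exact: knP.
- apply: (within_new_old (r := 0%N) r2 cS dS cS' _ h) => // wt.
  move=> [[Pwt ?] ?]; have [kn th ab sum _] := facts _ Pwt.
  by split=> //; three_cases a b c d; lra.
- apply: (within_new_old (r := 0%N) r2 cS dS bS' _ h) => // wt.
  move=> [[Pwt ?] ?]; have [kn th ab sum _] := facts _ Pwt.
  by split=> //; three_cases a b c d; lra.
- apply: (within_new_old (r := 2) r2 cS dS aS' _ h) => // wt.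
  move=> [[Pwt ?] ?]; have [kn th ab sum _] := facts _ Pwt.
  by split=> //; split=> //; lra.
- apply: (within_old_new (r := 0%N) r2 cS dS bS _ h) => // wt.
  move=> [[Pwt ?] ?]; have [kn th ab sum _] := facts _ Pwt.
  by split=> //; three_cases a b c d; lra.
(* Both exceed [a], so the sum keeps both below [b]; two coins in the same gap have the same, third,
   weight. *)
- apply: (within_new_old (r := 2) r2 cS dS cS' _ h) => // wt.
  move=> [[Pwt ?] ?]; have [kn th ab sum _] := facts _ Pwt.
  by split=> //; [split=> //|]; three_cases a b c d; lra.
Qed.

(** The mirror image of [within_light], with the order reversed and [a], [b] exchanged. *)
Lemma within_heavy m S f a b c d P : rank2 f S a b ->
    c \notin S -> d \notin c |: S ->
    (forall wt, P wt -> known f S wt) ->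
    (forall wt, P wt -> wt a + wt b < wt c + wt d) ->
    (forall wt, P wt -> wt c = wt b -> wt d <> wt b) ->
    within_any_rank3 m (d |: (c |: S)) P ->
  within m.+2 P.
Proof.
move=> r2 cS dS knP heavy notbb h.
have [aS bS _ _ _] := r2.
have [aS' bS'] : a \in c |: S /\ b \in c |: S by rewrite !setU1r.
have cS' : c \in c |: S by rewrite setU11.
have cb : c != b by apply: contraNneq cS => ->.
have db : d != b by apply: contraNneq dS => ->.
have facts wt : P wt -> [/\ known f S wt, three_valued wt, wt a < wt b,
    wt a + wt b < wt c + wt d & wt c = wt b -> wt d <> wt b].
  move=> Pwt; have kn := knP _ Pwt.
  by split; [|exact: kn.1|exact: rank2_lt kn|exact: heavy|exact: notbb].
apply: (within_weigh1 cb); apply: (within_weigh1 db).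
- apply: within_absurd => wt [[/facts[_ _ _ _ bb] ?] ?]; exact: bb.
- apply: (within_old_new (r := 2) r2 cS dS bS _ h) => // wt.
  move=> [[Pwt ?] ?]; have [kn th ab sum _] := facts _ Pwt.
  by split=> //; split=> //; lra.
- apply: (within_old_new (r := 4) r2 cS dS bS _ h) => // wt.
  by move=> [[Pwt ?] ?]; split=> //; exact: knP.
- apply: (within_new_old (r := 2) r2 cS dS bS' _ h) => // wt.
  move=> [[Pwt ?] ?]; have [kn th ab sum _] := facts _ Pwt.
  by split=> //; split=> //; lra.
- apply: (within_new_old (r := 2) r2 cS dS cS' _ h) => // wt.
  move=> [[Pwt ?] ?]; have [kn th ab sum _] := facts _ Pwt.
  by split=> //; [split=> //|]; three_cases a b c d; lra.
- apply: (within_old_new (r := 4) r2 cS dS aS _ h) => // wt.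
  move=> [[Pwt ?] ?]; have [kn th ab sum _] := facts _ Pwt.
  by split=> //; three_cases a b c d; lra.
- apply: (within_new_old (r := 4) r2 cS dS bS' _ h) => // wt.
  by move=> [[Pwt ?] ?]; split=> //; exact: knP.
- apply: (within_new_old (r := 4) r2 cS dS aS' _ h) => // wt.
  move=> [[Pwt ?] ?]; have [kn th ab sum _] := facts _ Pwt.
  by split=> //; three_cases a b c d; lra.
- apply: (within_new_old (r := 4) r2 cS dS cS' _ h) => // wt.
  move=> [[Pwt ?] ?]; have [kn th ab sum _] := facts _ Pwt.
  by split=> //; three_cases a b c d; lra.
Qed.

(** * Two coins for two weighings while no third weight shows up *)

(** The twin [c'] allows [2c] to be put on a pan. Two weighings either sort all four coins by the
    weights of [a] and [b], or reveal a third weight; locating it takes at most two more, and [m]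
    weighings remain for the other coins. *)
Lemma within_rank2_pair m S f a b c c' p p' P : rank2 f S a b ->
    c \notin S -> p \notin c |: S -> c' \notin p |: (c |: S) ->
    p' \notin c' |: (p |: (c |: S)) ->
    (forall wt, P wt -> [/\ known f S wt, wt c = wt c' & wt p = wt p']) ->
    (forall g Q, rank2 g (p' |: (c' |: (p |: (c |: S)))) a b ->
       (forall wt, Q wt -> known g (p' |: (c' |: (p |: (c |: S)))) wt) ->
       within m.+2 Q) ->
    (#|~: (p' |: (c' |: (p |: (c |: S))))| <= m)%N ->
  within m.+4 P.
Proof.
move=> r2 cS pS c'S p'S facts rec le_m; have [aS bS _ _ _] := r2.
set S4 := p' |: _ in rec le_m.
have knP wt : P wt -> known f S wt by case/facts.
have ca : c != a by apply: contraNneq cS => ->.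
have cb : c != b by apply: contraNneq cS => ->.
have pa : p != a by apply: contraNneq pS => ->; rewrite setU1r.
have pb : p != b by apply: contraNneq pS => ->; rewrite setU1r.
have cp : c != p by apply: contraNneq pS => <-; rewrite setU11.
have c'a : c' != a by apply: contraNneq c'S => ->; rewrite !setU1r.
have c'b : c' != b by apply: contraNneq c'S => ->; rewrite !setU1r.
have cc' : c != c' by apply: contraNneq c'S => <-; rewrite setU1r ?setU11.
have pc' : p != c' by apply: contraNneq c'S => <-; rewrite setU11.
have lt_ab wt : P wt -> wt a < wt b by move/knP; exact: rank2_lt.
have ab : a != b.
  by have [_ _ fa fb _] := r2; apply: contra_eqN fa => /eqP->; rewrite fb.
(* Once [c] and [p] are numbered, their twins take over the same numbers. *)
have lift g wt : wt c = wt c' -> wt p = wt p' -> known g (p |: (c |: S)) wt ->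
    known (put (put g c' (g c)) p' (put g c' (g c) p)) S4 wt.
  move=> ec ep kn; have kn' : known (put g c' (g c)) (c' |: (p |: (c |: S))) wt.
    by apply: known_put_eq; rewrite // setU1r ?setU11.
  by apply: known_put_eq; rewrite // setU1r ?setU11.
(* The end of the branches with a third weight: one weighing per coin outside the four. *)
have three Q : (forall wt, Q wt -> P wt) ->
    within_any_rank3 m (p |: (c |: S)) Q.
  move=> sQP g x y z r3; apply: (within_weaken le_m (fun _ => id)).
  apply: (within_rank3 (f := put (put g c' (g c)) p' (put g c' (g c) p))
    (x := x) (y := y) (z := z)).
    by do 2![apply: rank3_put => //].
  by move=> wt [/sQP/facts[_ ec ep] kn]; exact: lift.
(* The end of the branches without a third weight: [c] and [p] weigh as much as known coins, and the
   recursion goes on. *)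
have two u v Q : u \in S -> v \in S ->
    (forall wt, Q wt -> [/\ P wt, wt c = wt u & wt p = wt v]) -> within m.+2 Q.
  move=> uS vS hQ; pose h := put (put f c (f u)) p (put f c (f u) v).
  apply: (rec (put (put h c' (h c)) p' (put h c' (h c) p))).
    apply: rank2_put => //; last by rewrite setU1r ?setU11.
    apply: rank2_put => //; last by rewrite setU1r ?setU11.
    by apply: rank2_put; rewrite // ?setU1r //; apply: rank2_put.
  move=> wt /hQ[/facts[kn ec ep] cu pv]; apply: lift => //.
  by apply: known_put_eq; rewrite // ?setU1r //; exact: known_put_eq.
apply: (within_weigh2 (i := c) (j := p) (k := a) (l := b)).
- by rewrite /= !inE !negb_or cp ca cb pa pb ab.
- apply: (within_weigh1 cp).
  + have cS' : c \in c |: S by rewrite setU11.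
    (* Both coins are the mean of [a] and [b], so the third weight is already located and two
       weighings are left over. *)
    apply: (within_weaken (m := m) _ (fun _ => id)); first exact: leq_addl 2 m.
    apply: (within_new_old (r := 2) r2 cS pS cS' _ (three P _)) => // wt.
    move=> [[Pwt sum] eq]; have ltab := lt_ab _ Pwt.
    by split=> //; [exact: knP | split; lra].
  + apply: (two a b) => // wt [[Pwt sum] lt].
    have [th _] := knP _ Pwt; have ltab := lt_ab _ Pwt.
    by split=> //; three_cases a b c p; lra.
  + apply: (two b a) => // wt [[Pwt sum] lt].
    have [th _] := knP _ Pwt; have ltab := lt_ab _ Pwt.
    by split=> //; three_cases a b c p; lra.
- apply: (within_weigh2 (i := c) (j := c') (k := p) (l := a)).
  + by rewrite /= !inE !negb_or cc' cp ca c'a pa eq_sym pc'.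
  (* From [2c = p + a], the case [c = b] gives [p = 2b - a], and [p = b] gives [c = (a + b) / 2];
     both make [c + p] exceed [a + b]. Every other coincidence of weights yields [c = p = a]. *)
  + apply: (two a a) => // wt [[Pwt sum] eq].
    have [[th _] ec _] := facts _ Pwt; have ltab := lt_ab _ Pwt.
    by split=> //; three_cases a b c p; lra.
  (* An imbalance excludes [c = p = a], as [within_light] requires. *)
  + apply: (within_light r2 cS pS) (three _ _) => wt [[Pwt sum] lt] //.
      exact: knP.
    by have [_ ec _] := facts _ Pwt; lra.
  + apply: (within_light r2 cS pS) (three _ _) => wt [[Pwt sum] lt] //.
      exact: knP.
    by have [_ ec _] := facts _ Pwt; lra.
- apply: (within_weigh2 (i := c) (j := c') (k := p) (l := b)).
  + by rewrite /= !inE !negb_or cc' cp cb c'b pb eq_sym pc'.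
  + apply: (two b b) => // wt [[Pwt sum] eq].
    have [[th _] ec _] := facts _ Pwt; have ltab := lt_ab _ Pwt.
    by split=> //; three_cases a b c p; lra.
  + apply: (within_heavy r2 cS pS) (three _ _) => wt [[Pwt sum] lt] //.
      exact: knP.
    by have [_ ec _] := facts _ Pwt; lra.
  + apply: (within_heavy r2 cS pS) (three _ _) => wt [[Pwt sum] lt] //.
      exact: knP.
    by have [_ ec _] := facts _ Pwt; lra.
Qed.

(** Since [c] and [d] differ, they are neither both [a] nor both [b], so an unbalanced sum reveals a
    third weight. A kept pair [q] is carried along untouched. *)
Lemma within_rank2_unequal m S f a b c d q P : rank2 f S a b ->
    c \notin S -> d \notin c |: S -> avoids q c -> avoids q d ->
    pending S q P ->
    (forall wt, P wt -> known f S wt) -> (forall wt, P wt -> wt d < wt c) ->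
    (forall g Q, rank2 g (d |: (c |: S)) a b -> pending (d |: (c |: S)) q Q ->
       (forall wt, Q wt -> known g (d |: (c |: S)) wt) -> within m.+2 Q) ->
    (#|~: (d |: (c |: S))| - isSome q <= m)%N ->
  within m.+3 P.
Proof.
move=> r2 cS dS qc qd pend knP ltdc rec le_m; have [aS bS fa fb _] := r2.
have ca : c != a by apply: contraNneq cS => ->.
have cb : c != b by apply: contraNneq cS => ->.
have da : d != a by apply: contraNneq dS => ->; rewrite setU1r.
have db : d != b by apply: contraNneq dS => ->; rewrite setU1r.
have cd : c != d by apply: contraNneq dS => <-; rewrite setU11.
have ab : a != b by apply: contra_eqN fa => /eqP->; rewrite fb.
have pend2 Q : (forall wt, Q wt -> P wt) -> pending (d |: (c |: S)) q Q.
  by move=> sQP; do 2![apply: pending_setU1 => //]; exact: pending_sub pend.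
have three Q : (forall wt, Q wt -> P wt) ->
    within_any_rank3 m (d |: (c |: S)) Q.
  move=> sQP g x y z r3; apply: (within_weaken le_m (fun _ => id)).
  by apply: (within_rank3_pending r3) => [|wt []//]; apply: pend2 => wt [/sQP].
apply: (within_weigh2 (i := c) (j := d) (k := a) (l := b)).
- by rewrite /= !inE !negb_or cd ca cb da db ab.
- apply: (rec (put (put f c (f b)) d (put f c (f b) a))).
  + by apply: rank2_put; rewrite // ?setU1r //; exact: rank2_put.
  + by apply: pend2 => wt [].
  move=> wt [Pwt sum]; have kn := knP _ Pwt; have [th _] := kn.
  have ltab := rank2_lt r2 kn; have ltdc' := ltdc _ Pwt.
  have [cb' da'] : wt c = wt b /\ wt d = wt a.
    by split; three_cases a b c d; lra.
  by apply: known_put_eq; rewrite // ?setU1r //; exact: known_put_eq.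
- apply: (within_light r2 cS dS) (three _ _) => wt [Pwt sum] //; first exact: knP.
  by have := ltdc _ Pwt; lra.
- apply: (within_heavy r2 cS dS) (three _ _) => wt [Pwt sum] //; first exact: knP.
  by have := ltdc _ Pwt; lra.
Qed.

(** * The recursion with two known weights *)

(** The invariant is two spare weighings beyond the unsorted coins, less one while a pair is kept.
    With fewer than two coins outside [S] and the kept pair, the spare weighings finish directly;
    otherwise two such coins are compared. *)
Lemma within_rank2 m S f a b q P : rank2 f S a b -> pending S q P ->
    (forall wt, P wt -> known f S wt) ->
    (#|~: S| + 2 - isSome q <= m)%N ->
  within m P.
Proof.
elim/ltn_ind: m S f q P => m IH S f q P r2 pend knP le_m.
case: (pickP [pred i | i \notin S & avoids q i]) => [c /= /andP[cS qc]|none];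
    last first.
  case: q pend none le_m => [[p p'] /= [pS p'S pp' eqpp] none|_ none _]; last first.
    have ST : S = [set: 'I_n].
      by apply/setP=> i; rewrite inE; have /= := none i; rewrite andbT => /negbFE.
    by apply: (within_sorted _ (f := f)) => wt /knP; rewrite ST.
  rewrite (cardsCU2 pS p'S pp') => le_m.
  apply: (within_weaken (m := 2) _ (fun _ => id)); first by move: le_m; clear; lia.
  apply: (within_last r2 pS _ eqpp knP) => i; move: (none i) => /=.
  by rewrite !inE; case: (i \in S); case: eqP => //; case: eqP.
case: (pickP [pred i | i \notin c |: S & avoids q i]) => [d /= /andP[dS qd]|none];
    last first.
  case: q pend qc none le_m => [[p p']|_ _ none] /=; last first.
    rewrite (cardsCU1 cS) => le_m.
    apply: (within_weaken (m := 2) _ (fun _ => id)); first by move: le_m; clear; lia.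
    apply: (within_last (p := c) (p' := c) r2 cS) => // i; rewrite setU1r //.
    by have /= := none i; rewrite andbT => /negbFE.
  move=> [pS p'S pp' eqpp] /andP[cp cp'] none.
  have pS1 : p \notin c |: S by rewrite !inE negb_or eq_sym cp.
  have p'S1 : p' \notin c |: S by rewrite !inE negb_or eq_sym cp'.
  rewrite (cardsCU1 cS) (cardsCU2 pS1 p'S1 pp') => le_m.
  apply: (within_weaken (m := 4) _ (fun _ => id)); first by move: le_m; clear; lia.
  apply: (within_locate r2 cS knP) => [r rP|e eS].
    have [x [y [z r3]]] := rank2_put_new r2 cS rP.
    apply: (within_weaken (m := 1) _ (fun _ => id)) => //.
    have cards : (#|~: (c |: S)| - isSome (Some (p, p')) = 1)%N.
      have S3T : p' |: (p |: (c |: S)) = [set: 'I_n].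
        apply/setP=> i; move: (none i) => /=; rewrite !inE.
        by case: (i \in S); case: (i == c); case: eqP => //; case: eqP.
      by rewrite (cardsCU2 pS1 p'S1 pp') S3T setCT cards0.
    rewrite -cards; apply: (within_rank3_pending r3) => [|wt [/knP kn]].
      by split=> // wt [/eqpp].
    exact: known_put_new.
  apply: (within_last (p := p) (p' := p') (rank2_put r2 cS eS) pS1).
  - move=> i; move: (none i) => /=; rewrite !inE.
    by case: (i \in S); case: (i == c); case: eqP => //; case: eqP.
  - by move=> wt [/eqpp].
  - by move=> wt [/knP kn ce]; exact: known_put_eq.
have cd : c != d by apply: contraNneq dS => <-; rewrite setU11.
have dS' : d \notin S by apply: contra dS => dS; rewrite setU1r.
have cS' : c \notin d |: S by rewrite !inE negb_or cd.
have sw : d |: (c |: S) = c |: (d |: S) by rewrite setUCA.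
(* Stated for [u] and [v] so as to serve both unbalanced outcomes; [u] is the heavier coin. The
   budget [m.-1] accounts for the comparison just made. *)
have unequal u v Q : u \notin S -> v \notin u |: S ->
    d |: (c |: S) = v |: (u |: S) ->
    avoids q u -> avoids q v -> (forall wt, Q wt -> P wt /\ wt v < wt u) ->
    within m.-1 Q.
  move=> uS vS sw' qu qv hQ.
  have uv : u != v by apply: contraNneq vS => <-; rewrite setU11.
  have ge : (#|~: S| = #|~: (v |: (u |: S))|.+2)%N.
    by apply: cardsCU2 => //; apply: contra vS => vS; rewrite setU1r.
  have pend2 : pending (v |: (u |: S)) q P by do 2![apply: pending_setU1 => //].
  (* A kept pair lies among the remaining coins, so the truncated subtraction of [isSome q] is exact
     and [m] is at least 4. *)
  have isq : (isSome q <= #|~: (v |: (u |: S))|)%N.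
    case: q pend2 {pend qc qd qu qv IH le_m} => [[p p'] [pS _ _ _]|_ //].
    by rewrite card_gt0; apply/set0Pn; exists p; rewrite inE.
  have arith k (s : bool) : (s <= k -> k.+2 + 2 - s <= m ->
      [/\ m.-1 = (m - 4).+3, (m - 4).+2 < m, k + 2 - s <= (m - 4).+2
        & k - s <= m - 4])%N.
    by clear; case: s => ? ?; split; lia.
  rewrite ge in le_m; have [-> lt_m le_rec le_rest] := arith _ _ isq le_m.
  apply: (within_rank2_unequal r2 uS vS qu qv (pending_sub _ pend)) => //.
  - by move=> wt /hQ[].
  - by move=> wt /hQ[/knP].
  - by move=> wt /hQ[].
  - by move=> g Q' r2' pend' knQ'; exact: (IH _ lt_m _ _ _ _ r2' pend' knQ').
have cards := cardsCU2 cS dS' cd.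
case: m IH le_m unequal => [|m] IH le_m unequal; first by move: le_m; clear; lia.
apply: (within_weigh1 cd); last 2 first.
- by apply: (unequal d c) => // wt [].
- by apply: (unequal c d) => // wt [].
case: q pend qc qd le_m {unequal} => [[p p']|] /=; last first.
  (* The balanced pair is kept: [S] does not grow, and the weighing spent is matched by the lower
     budget. *)
  move=> _ _ _ le_m; apply: (IH m _ S f (Some (c, d))) => //=;
    last by move: le_m; rewrite cards; clear; lia.
  - by split=> // wt [].
  - by move=> wt [/knP].
move=> [pS p'S pp' eqpp] /andP[cp cp'] /andP[dp dp'] le_m.
have pS1 : p \notin c |: S by rewrite !inE negb_or eq_sym cp.
have dS2 : d \notin p |: (c |: S) by rewrite in_setU1 negb_or dp.
have p'S3 : p' \notin d |: (p |: (c |: S)).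
  by rewrite !inE !negb_or [p' == d]eq_sym [p' == p]eq_sym [p' == c]eq_sym dp' pp' cp'.
have cards4 : #|~: S| = #|~: (p' |: (d |: (p |: (c |: S))))|.+4.
  by rewrite (cardsCU1 cS) (cardsCU1 pS1) (cardsCU1 dS2) (cardsCU1 p'S3).
have arith k : (k.+4 + 2 - 1 <= m.+1 ->
    [/\ m = (m - 4).+4, (m - 4).+2 < m.+1, k + 2 - 0 <= (m - 4).+2
      & k <= m - 4])%N.
  by clear; move=> ?; split; lia.
rewrite cards4 in le_m; have [def_m lt_m le_rec le_rest] := arith _ le_m.
rewrite def_m.
apply: (within_rank2_pair r2 cS pS1 dS2 p'S3) => [wt [Pwt cd']|g Q r2' knQ|//].
  by split=> //; [exact: knP | exact: eqpp].
exact: (IH _ lt_m _ _ None _ r2' I knQ le_rec).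
Qed.

(** * The start: looking for a coin that differs *)

(** Each balance with [a] sorts one coin for one weighing. So does the first imbalance, which gives
    two weights with both spare weighings still available. *)
Lemma within_balanced m S a P : a \in S ->
    (forall wt, P wt -> three_valued wt /\ {in S, forall i, wt i = wt a}) ->
    (#|~: S| + 2 <= m)%N ->
  within m P.
Proof.
elim: m S P => [|m IH] S P aS knP; first by rewrite addn2.
case: (set_0Vmem (~: S)) => [ST | [c]] => [_|].
  apply: (within_sorted _ (f := fun=> 0%N)) => wt /knP[th eqa].
  rewrite -[S]setCK ST setC0 in eqa.
  by split=> // i j _ _; rewrite !eqa ?inE // ltxx.
rewrite inE => cS; rewrite (cardsCU1 cS) => le_m.
have ca : c != a by apply: contraNneq cS => ->.
apply: (within_weigh1 ca).
- apply: (IH (c |: S)) => [|wt [/knP[th eqa] ca']|//]; first by rewrite setU1r.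
  by split=> // i; rewrite !inE => /orP[/eqP->|/eqa].
(* The lighter coin [c] gets 1, all coins of [S] get 3; in the other branch the numbers are
   swapped. *)
- apply: (within_rank2 (S := c |: S) (a := c) (b := a) (q := None)
    (f := fun i => if i == c then 1%N else 3)) => //; last by rewrite /= subn0.
  + split; rewrite ?setU11 ?setU1r ?eqxx // 1?eq_sym ?(negbTE ca) //.
    by move=> i _; rewrite ?eqxx; case: (i == c); [left | right].
  + move=> wt [/knP[th eqa] lt]; split=> // i j.
    rewrite !inE; case: (eqVneq i c) => [->|_]; case: (eqVneq j c) => [->|_] /=.
    * by rewrite ltxx.
    * by move=> _ /eqa->.
    * by move=> /eqa-> _; rewrite ltNge ltW.
    * by move=> /eqa-> /eqa->; rewrite ltxx.
- apply: (within_rank2 (S := c |: S) (a := a) (b := c) (q := None)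
    (f := fun i => if i == c then 3 else 1%N)) => //; last by rewrite /= subn0.
  + split; rewrite ?setU11 ?setU1r ?eqxx // 1?eq_sym ?(negbTE ca) //.
    by move=> i _; rewrite ?eqxx; case: (i == c); [right | left].
  + move=> wt [/knP[th eqa] lt]; split=> // i j.
    rewrite !inE; case: (eqVneq i c) => [->|_]; case: (eqVneq j c) => [->|_] /=.
    * by rewrite ltxx.
    * by move=> _ /eqa->; rewrite ltNge ltW.
    * by move=> /eqa-> _.
    * by move=> /eqa-> /eqa->; rewrite ltxx.
Qed.

Lemma three_valued_mem w1 w2 w3 wt :
  (forall i, wt i \in [:: w1; w2; w3]) -> three_valued wt.
Proof.
move=> wtP i j k l; apply/negP => uniq4.
suff /(uniq_leq_size uniq4) :
  {subset [:: wt i; wt j; wt k; wt l] <= [:: w1; w2; w3]} by [].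
by move=> w /predU1P[->|/predU1P[->|/predU1P[->|/predU1P[->|]]]].
Qed.

End Sorting.

Theorem theorem7p1 (R : realFieldType) (n : nat) (n_ge1 : (1 <= n)%N) :
  exists s : strategy n, sorts_within R n.+1 s.
Proof.
pose c := Ordinal n_ge1.
have [s sP] : within n.+1 (fun wt : 'I_n -> R => three_valued wt).
  (* One coin counts as sorted at the start; the other [n - 1] and the two spare weighings make
     [n + 1]. *)
  apply: (@within_balanced _ _ _ [set c] c); rewrite ?inE //.
    by move=> wt th; split=> // i; rewrite inE => /eqP->.
  by rewrite cardsC1 card_ord addn2 prednK.
exists s => w1 w2 w3 wt _ _ wtP.
exact: sP (three_valued_mem wtP).
Qed.
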